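(* Let $\alpha \geq 0$ be real. Then for all $u\in C_c(\mathbb{N})$ with $u_0=0$, $$\sum_{n=1}^{\infty} n^\alpha |\nabla u_n|^2 \geq \frac{(\alpha-1)^2}{4} \sum_{n=1}^{\infty} n^{\alpha-2} u_n^2.$$
   Context: $\mathbb{N}=\{0,1,2,\dots\}$, $C_c(\mathbb{N})$ is the space of finitely supported real sequences $u=(u_n)_{n\in\mathbb{N}}$, and $\nabla u_n = u_n-u_{n-1}$ for $n\geq 1$. *)

(* Defs.v *)
From Stdlib Require Import Reals Lra Lia.
From Coquelicot Require Import Coquelicot.
Open Scope R_scope.

Definition finitely_supported (u : nat -> R) : Prop :=
  exists N : nat, forall n : nat, (N <= n)%nat -> u n = 0.

(* Only meant for [n >= 1]; at [n = 0] truncated subtraction gives 0. *)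
Definition nabla (u : nat -> R) (n : nat) : R := u n - u (n - 1)%nat.

(* The sum of [a n] over [n >= 1]. *)
Definition Series_from_1 (a : nat -> R) : R := Series (fun k : nat => a (S k)).

(* [Series] has an unspecified value on divergent series; both series in the
   weighted Hardy inequality converge, by the three lemmas below. *)
Lemma ex_series_from_1_finitely_supported (a : nat -> R) :
  finitely_supported a -> ex_series (fun k : nat => a (S k)).
Proof.
  intros [N HN].
  apply (ex_series_incr_n _ N).
  apply ex_series_ext with (fun _ : nat => 0).
  - intros n. symmetry. apply HN. lia.
  - exists 0. apply is_series_Reals. intros eps Heps. exists 0%nat. intros n _.
    rewrite sum_eq_R0; [ | intros; reflexivity ].
    unfold Rdist. rewrite Rminus_0_r, Rabs_R0. exact Heps.
Qed.

Lemma finitely_supported_weighted_sqr (u w : nat -> R) :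
  finitely_supported u -> finitely_supported (fun n => w n * u n ^ 2).
Proof.
  intros [N HN]. exists N. intros n Hn. rewrite (HN n Hn). ring.
Qed.

Lemma finitely_supported_weighted_nabla_sqr (u w : nat -> R) :
  finitely_supported u ->
  finitely_supported (fun n => w n * Rabs (nabla u n) ^ 2).
Proof.
  intros [N HN]. exists (S N). intros n Hn. unfold nabla.
  rewrite (HN n), (HN (n - 1)%nat) by lia.
  rewrite Rminus_0_r, Rabs_R0. ring.
Qed.

(* Main.v *)
(** For a positive sequence [h], approximating the ground state, put
    [p_n = h_(n-1) / h_n - 1].  The inequality
    [(x - y)^2 >= p / (1 + p) * y^2 - p * x^2] on each edge reduces a weighted
    Hardy inequality to the discrete Riccati inequality
    [c * w_n + a_n * p_n <= a_(n+1) * p_(n+1) / (1 + p_(n+1))].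
    The continuous ground state [t^(-b)], [b = (alpha - 1) / 2], suggests
    [p_n = b / (n + d)].  With [x = 1 / n] the Riccati inequality compares
    [(1 + x)^alpha] with a rational function of [x], and Bernoulli's inequality
    settles it with [d = -1/2] for [alpha <= 1], [d = 1] for
    [1 <= alpha <= 2] and [d = 0] for [alpha >= 2]. *)

Require Import Defs.
From Stdlib Require Import Reals Lra Lia.
From Coquelicot Require Import Coquelicot.
Open Scope R_scope.

(** With [s = ln y], the bound [1 + v <= exp v] is used at [v = (1 - g) * s] and [v = - (g * s)].
    Weighting the results [H1] and [H2] by [g] and [1 - g] cancels [s]. *)
Lemma Rpower_bernoulli_le (y g : R) :
  0 < y -> 0 <= g <= 1 -> Rpower y g <= 1 + g * (y - 1).
Proof.
  intros Hy Hg. unfold Rpower. set (s := ln y).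
  assert (H1 : exp (g * s) * (1 + (1 - g) * s) <= y).
  { rewrite <- (exp_ln y Hy). fold s.
    replace (exp s) with (exp (g * s) * exp ((1 - g) * s))
      by (rewrite <- exp_plus; f_equal; ring).
    apply Rmult_le_compat_l; [ left; apply exp_pos | apply exp_ineq1_le ]. }
  assert (H2 : exp (g * s) * (1 + - (g * s)) <= 1).
  { apply Rle_trans with (exp (g * s) * exp (- (g * s))).
    - apply Rmult_le_compat_l; [ left; apply exp_pos | apply exp_ineq1_le ].
    - rewrite <- exp_plus, Rplus_opp_r, exp_0. lra. }
  nra.
Qed.

(** The previous bound, applied to [Rpower y g] with exponent [/ g]. *)
Lemma Rpower_bernoulli_ge (y g : R) :
  0 < y -> 1 <= g -> 1 + g * (y - 1) <= Rpower y g.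
Proof.
  intros Hy Hg.
  assert (Hinv : 0 <= / g <= 1).
  { split; [ left; apply Rinv_0_lt_compat; lra | ].
    rewrite <- Rinv_1. apply Rinv_le_contravar; lra. }
  assert (H := Rpower_bernoulli_le (Rpower y g) (/ g) (exp_pos _) Hinv).
  rewrite Rpower_mult, Rinv_r, Rpower_1 in H by lra.
  apply (Rmult_le_compat_l g) in H; [ | lra ].
  replace (g * (1 + / g * (Rpower y g - 1))) with (g + (Rpower y g - 1)) in H
    by (field; lra).
  lra.
Qed.

(** The defect is a square over [1 + p]. It vanishes for [y = (1 + p) * x], the relation between
    neighbouring values of the ground state. *)
Lemma edge_lower_bound (p x y : R) :
  -1 < p -> p / (1 + p) * y ^ 2 - p * x ^ 2 <= (x - y) ^ 2.
Proof.
  intros Hp.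
  assert (H : (x - y) ^ 2 - (p / (1 + p) * y ^ 2 - p * x ^ 2)
              = ((1 + p) * x - y) ^ 2 / (1 + p)) by (field; lra).
  assert (0 <= ((1 + p) * x - y) ^ 2 / (1 + p)).
  { apply Rdiv_le_0_compat; [ apply pow2_ge_0 | lra ]. }
  lra.
Qed.

(* At [n = 1] the edge ends at [u 0 = 0], so [p 1 = -1] is still allowed. *)
Lemma hardy_of_riccati (a w p : nat -> R) (c : R) (u : nat -> R) :
  (forall n, 0 <= a n) -> -1 <= p 1%nat ->
  (forall n, (1 <= n)%nat -> -1 < p (S n)) ->
  (forall n, (1 <= n)%nat ->
     c * w n + a n * p n <= a (S n) * (p (S n) / (1 + p (S n)))) ->
  finitely_supported u -> u 0%nat = 0 ->
  c * Series_from_1 (fun n => w n * u n ^ 2)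
  <= Series_from_1 (fun n => a n * Rabs (nabla u n) ^ 2).
Proof.
  intros Ha Hp1 Hp Hric Hu Hu0.
  set (d := fun k => a (S k) * Rabs (nabla u (S k)) ^ 2
                     - c * (w (S k) * u (S k) ^ 2)).
  (* The edge bounds telescope, leaving only a boundary term at vertex [S N], which is zero beyond
     the support. *)
  assert (Hpartial : forall N,
    - (a (S (S N)) * (p (S (S N)) / (1 + p (S (S N))))) * u (S N) ^ 2
    <= sum_n d N).
  { assert (Hvertex : forall n, (1 <= n)%nat ->
      - (a (S n) * (p (S n) / (1 + p (S n)))) * u n ^ 2
      <= - (a n * p n) * u n ^ 2 - c * (w n * u n ^ 2)).
    { intros n Hn. specialize (Hric n Hn). assert (H := pow2_ge_0 (u n)). nra. }
    induction N as [|N IH].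
    - rewrite sum_O. unfold d, nabla.
      eapply Rle_trans; [ apply (Hvertex 1%nat); lia | ].
      (* The first edge contributes [a 1 * u 1 ^ 2], which is at least [- (a 1 * p 1) * u 1 ^ 2]
         because [p 1 >= -1]. *)
      rewrite pow2_abs. simpl (1 - 1)%nat. rewrite Hu0.
      assert (0 <= a 1%nat * u 1%nat ^ 2)
        by (apply Rmult_le_pos; [ apply Ha | apply pow2_ge_0 ]).
      nra.
    - rewrite sum_Sn. change (plus (sum_n d N) (d (S N))) with (sum_n d N + d (S N)).
      eapply Rle_trans; [ apply (Hvertex (S (S N))); lia | ].
      unfold d at 2, nabla. rewrite pow2_abs.
      replace (S (S N) - 1)%nat with (S N) by lia.
      assert (He := edge_lower_bound (p (S (S N))) (u (S (S N))) (u (S N))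
                      (Hp (S N) ltac:(lia))).
      apply (Rmult_le_compat_l (a (S (S N)))) in He; [ | apply Ha ].
      lra. }
  assert (HexL := ex_series_from_1_finitely_supported _
    (finitely_supported_weighted_nabla_sqr u a Hu)).
  assert (HexR := ex_series_from_1_finitely_supported _
    (finitely_supported_weighted_sqr u w Hu)).
  assert (HexcR : ex_series (fun k => c * (w (S k) * u (S k) ^ 2)))
    by (apply (ex_series_scal (K := R_AbsRing) (V := R_NormedModule) c _ HexR)).
  unfold Series_from_1. rewrite <- Series_scal_l.
  apply Rminus_le_0. rewrite <- Series_minus by assumption.
  assert (Hd : ex_series d) by (apply (ex_series_minus _ _ HexL HexcR)).
  destruct Hu as [M HM].
  apply (is_lim_seq_le_loc (fun _ => 0) (sum_n d) 0 (Series d)).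
  - exists M. intros N HN. eapply Rle_trans; [ | apply Hpartial ].
    rewrite (HM (S N)) by lia. lra.
  - apply is_lim_seq_const.
  - apply (Series_correct _ Hd).
Qed.

(* The factor [b] in the last hypothesis is kept because its sign is that of
   [alpha - 1] in the application. *)
Lemma riccati_of_rational_bound (alpha b d t : R) :
  1 <= t -> 0 < t + d -> 0 < t + 1 + d + b ->
  0 <= b * (Rpower (1 + / t) alpha * (1 + d * / t)
            - (1 + (1 + d + b) * / t) * (1 + b * / t * (1 + d * / t))) ->
  b ^ 2 * Rpower t (alpha - 2) + Rpower t alpha * (b / (t + d))
  <= Rpower (t + 1) alpha * (b / (t + 1 + d) / (1 + b / (t + 1 + d))).
Proof.
  intros Ht Hd Hdb H.
  assert (Hi : 0 < / t) by (apply Rinv_0_lt_compat; lra).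
  assert (E1 : Rpower (t + 1) alpha = Rpower t alpha * Rpower (1 + / t) alpha).
  { rewrite Rpower_mult_distr by lra. f_equal. field. lra. }
  assert (E2 : Rpower t (alpha - 2) = Rpower t alpha * (/ t) ^ 2).
  { unfold Rminus. rewrite Rpower_plus, Rpower_Ropp.
    change 2 with (INR 2). rewrite Rpower_pow by lra. rewrite pow_inv. reflexivity. }
  rewrite E1, E2. set (T := Rpower t alpha).
  assert (HT : 0 < T) by apply exp_pos.
  set (P := Rpower (1 + / t) alpha) in *.
  apply Rminus_le_0.
  (* The difference of the two sides is the expression in [H] times a positive factor. *)
  replace (T * P * (b / (t + 1 + d) / (1 + b / (t + 1 + d)))
           - (b ^ 2 * (T * (/ t) ^ 2) + T * (b / (t + d))))
    with (T * (t / ((t + d) * (t + 1 + d + b)))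
          * (b * (P * (1 + d * / t)
             - (1 + (1 + d + b) * / t) * (1 + b * / t * (1 + d * / t)))))
    by (field; lra).
  apply Rmult_le_pos; [ | exact H ].
  apply Rmult_le_pos; [ lra | ].
  apply Rdiv_le_0_compat; [ lra | ].
  apply Rmult_lt_0_compat; lra.
Qed.

(** Bernoulli with exponent [2 * b + 1] in [[0, 1]] leaves a polynomial inequality whose constant
    and linear terms cancel. *)
Lemma rational_bound_alpha_le_1 (b x : R) :
  -1 / 2 <= b <= 0 -> 0 < x <= 1 ->
  Rpower (1 + x) (2 * b + 1) * (1 + - (1 / 2) * x)
  <= (1 + (1 + - (1 / 2) + b) * x) * (1 + b * x * (1 + - (1 / 2) * x)).
Proof.
  intros Hb Hx.
  assert (H := Rpower_bernoulli_le (1 + x) (2 * b + 1) ltac:(lra) ltac:(lra)).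
  apply Rle_trans with ((1 + (2 * b + 1) * (1 + x - 1)) * (1 + - (1 / 2) * x)).
  { apply Rmult_le_compat_r; [ lra | exact H ]. }
  apply Rminus_le_0.
  match goal with |- 0 <= ?e =>
    replace e with (x ^ 2 * (b ^ 2 + (2 * b + 1) / 2 + (2 * b + 1) * - b * x / 4))
      by field end.
  apply Rmult_le_pos; [ apply pow2_ge_0 | ].
  assert (0 <= (2 * b + 1) * - b * x)
    by (repeat apply Rmult_le_pos; lra).
  nra.
Qed.

(* Bernoulli for the exponent [1 - 2 * b] in [[0, 1]] gives
   [(1 + x)^(2 b + 1) >= (1 + x)^2 / (1 + (1 - 2 b) x)]. *)
Lemma rational_bound_alpha_1_2 (b x : R) :
  0 <= b <= 1 / 2 -> 0 < x <= 1 ->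
  (1 + (1 + 1 + b) * x) * (1 + b * x * (1 + 1 * x))
  <= Rpower (1 + x) (2 * b + 1) * (1 + 1 * x).
Proof.
  intros Hb Hx.
  assert (H := Rpower_bernoulli_le (1 + x) (1 - 2 * b) ltac:(lra) ltac:(lra)).
  set (P := Rpower (1 + x) (2 * b + 1)).
  set (Q := Rpower (1 + x) (1 - 2 * b)) in *.
  assert (HP : 0 < P) by apply exp_pos.
  assert (HPQ : P * Q = (1 + x) ^ 2).
  { unfold P, Q. rewrite <- Rpower_plus.
    replace (2 * b + 1 + (1 - 2 * b)) with (INR 2) by (simpl; ring).
    apply Rpower_pow. lra. }
  assert (Hm : 0 < 1 + (1 - 2 * b) * x) by nra.
  apply Rmult_le_reg_r with (1 := Hm).
  apply Rle_trans with ((1 + x) ^ 3).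
  2:{ replace ((1 + x) ^ 3) with (P * Q * (1 + 1 * x)) by (rewrite HPQ; ring).
      assert (P * Q <= P * (1 + (1 - 2 * b) * x))
        by (apply Rmult_le_compat_l; lra).
      nra. }
  apply Rminus_le_0.
  (* The cofactor of [x ^ 2] is split along [1 - x], [x] and [x * (1 - x)], with coefficients
     nonnegative for [b] in [[0, 1/2]]. *)
  match goal with |- 0 <= ?e =>
    replace e with (x ^ 2 * ((1 - x) * (1 - b + 3 * b ^ 2)
      + x * (2 - 8 * b + 10 * b ^ 2 + 4 * b ^ 3)
      + b * (2 - 3 * b - 2 * b ^ 2) * (x * (1 - x))))
      by ring end.
  apply Rmult_le_pos; [ apply pow2_ge_0 | ].
  assert (0 <= 4 * b ^ 3) by (assert (0 <= b ^ 3) by (apply pow_le; lra); lra).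
  repeat apply Rplus_le_le_0_compat; repeat apply Rmult_le_pos; nra.
Qed.

(** Bernoulli is applied to half the exponent and squared, to gain a quadratic term:
    [(1 + (b + 1/2) * x) ^ 2] exceeds the left side by [x ^ 2 / 4]. *)
Lemma rational_bound_alpha_ge_2 (b x : R) :
  1 / 2 <= b -> 0 < x ->
  (1 + (1 + 0 + b) * x) * (1 + b * x * (1 + 0 * x))
  <= Rpower (1 + x) (2 * b + 1) * (1 + 0 * x).
Proof.
  intros Hb Hx.
  assert (H := Rpower_bernoulli_ge (1 + x) (b + 1 / 2) ltac:(lra) ltac:(lra)).
  replace (2 * b + 1) with (b + 1 / 2 + (b + 1 / 2)) by field.
  rewrite Rpower_plus.
  set (Q := Rpower (1 + x) (b + 1 / 2)) in *.
  replace (1 + x - 1) with x in H by ring.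
  assert (0 < (b + 1 / 2) * x) by (apply Rmult_lt_0_compat; lra).
  assert ((1 + (b + 1 / 2) * x) * (1 + (b + 1 / 2) * x) <= Q * Q)
    by (apply Rmult_le_compat; lra).
  assert (0 <= x ^ 2) by apply pow2_ge_0.
  lra.
Qed.

Lemma weighted_hardy_of_rational_bound (b d : R) (u : nat -> R) :
  0 < 1 + d -> 0 <= 1 + d + b ->
  (forall x, 0 < x <= 1 ->
     0 <= b * (Rpower (1 + x) (2 * b + 1) * (1 + d * x)
            - (1 + (1 + d + b) * x) * (1 + b * x * (1 + d * x)))) ->
  finitely_supported u -> u 0%nat = 0 ->
  b ^ 2 * Series_from_1 (fun n => Rpower (INR n) (2 * b + 1 - 2) * u n ^ 2)
  <= Series_from_1 (fun n => Rpower (INR n) (2 * b + 1) * Rabs (nabla u n) ^ 2).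
Proof.
  intros Hd Hdb Hx Hu Hu0.
  apply (hardy_of_riccati (fun n => Rpower (INR n) (2 * b + 1))
           (fun n => Rpower (INR n) (2 * b + 1 - 2)) (fun n => b / (INR n + d)));
    try assumption.
  (* [Rpower] is an exponential by definition, so it is positive even at [n = 0]. *)
  - intros n. left. apply exp_pos.
  - simpl. apply (Rmult_le_reg_r (1 + d)); [ lra | ].
    replace (b / (1 + d) * (1 + d)) with b by (field; lra). lra.
  - intros n Hn. apply le_INR in Hn. simpl INR in Hn. rewrite S_INR.
    apply (Rmult_lt_reg_r (INR n + 1 + d)); [ lra | ].
    replace (b / (INR n + 1 + d) * (INR n + 1 + d)) with b by (field; lra). lra.
  - intros n Hn. apply le_INR in Hn. simpl INR in Hn. rewrite S_INR.
    apply riccati_of_rational_bound; try lra.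
    apply Hx. split; [ apply Rinv_0_lt_compat; lra | ].
    rewrite <- Rinv_1. apply Rinv_le_contravar; lra.
Qed.

Theorem theorem1p3 :
  forall alpha : R, 0 <= alpha ->
  forall u : nat -> R, finitely_supported u -> u 0%nat = 0 ->
    Series_from_1 (fun n => Rpower (INR n) alpha * Rabs (nabla u n) ^ 2)
    >= (alpha - 1) ^ 2 / 4 *
       Series_from_1 (fun n => Rpower (INR n) (alpha - 2) * u n ^ 2).
Proof.
  intros alpha Halpha u Hu Hu0. apply Rle_ge.
  set (b := (alpha - 1) / 2).
  replace ((alpha - 1) ^ 2 / 4) with (b ^ 2) by (unfold b; field).
  replace alpha with (2 * b + 1) by (unfold b; field).
  assert (Hb : -1 / 2 <= b) by (unfold b; lra).
  clearbody b.
  destruct (Rle_dec b 0) as [Hb0|Hb0]; [ | destruct (Rle_dec b (1 / 2)) as [Hb1|Hb1] ].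
  (* At [b = -1/2], that is [alpha = 0], this shift gives exactly [p 1 = -1]. *)
  - apply (weighted_hardy_of_rational_bound b (- (1 / 2))); try assumption; try lra.
    intros x Hx.
    assert (H := rational_bound_alpha_le_1 b x ltac:(lra) Hx). nra.
  - apply (weighted_hardy_of_rational_bound b 1); try assumption; try lra.
    intros x Hx.
    assert (H := rational_bound_alpha_1_2 b x ltac:(lra) Hx).
    apply Rmult_le_pos; lra.
  - apply (weighted_hardy_of_rational_bound b 0); try assumption; try lra.
    intros x Hx.
    assert (H := rational_bound_alpha_ge_2 b x ltac:(lra) ltac:(lra)).
    apply Rmult_le_pos; lra.
Qed.
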